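(* Let $R$, $R'$ and $S$ be TRSs over $\Sigma$ and $T\subseteq\mathcal{T}(\Sigma,\emptyset)$. Let $\mathcal{A}=(A,[\![\cdot]\!],\ge)$ be a monotone partial model for $R\cup R'\cup S$ with $T\subseteq\mathcal{L}(\mathcal{A})$ such that for all rules $\ell\to r\in R'$ and all $\alpha:\mathrm{Var}(\ell)\to A$ the interpretation $[\![\ell]\!]_\alpha$ is undefined. Then if $R$ is terminating relative to $S$ on $T$, also $R\cup R'$ is terminating relative to $S$ on $T$.
   Context: TRS: set of rules $\ell\to r$ ($\ell\notin\mathcal{X}$, $\mathrm{Var}(r)\subseteq\mathrm{Var}(\ell)$). $P$ is terminating relative to $Q$ on $T$ if $\to_Q^*\cdot\to_P\cdot\to_Q^*$ admits no infinite sequence starting in $T$. Partial $\Sigma$-algebra $(A,[\![\cdot]\!])$: partial $[\![f]\!]:A^n\rightharpoonup A$; $[\![x]\!]_\alpha=\alpha(x)$, $[\![f(t_1,..,t_n)]\!]_\alpha=[\![f]\!]([\![t_1]\!]_\alpha,..,[\![t_n]\!]_\alpha)$, defined only if all subexpressions are; $\mathcal{L}(\mathcal{A})$ = ground terms $t$ with $[\![t]\!]$ defined. $(A,[\![\cdot]\!],\ge)$ is a monotone partial model for a TRS $P$ if each $[\![f]\!]$ is closed w.r.t. $\ge$ ($f(\dots,a,\dots)$ defined and $a\ge b$ imply $f(\dots,b,\dots)$ defined) and monotone w.r.t. $\ge$ (if both defined and $a\ge b$ then $f(\dots,a,\dots)\ge f(\dots,b,\dots)$), and for all $\ell\to r\in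 P$ and $\alpha:\mathrm{Var}(\ell)\to A$ with $[\![\ell]\!]_\alpha$ defined, $[\![\ell]\!]_\alpha\ge[\![r]\!]_\alpha$ (both defined). *)

(* Defs.v *)
From Stdlib Require Import Relation_Operators.
From mathcomp Require Import all_boot.

Set Implicit Arguments.
Unset Strict Implicit.
Unset Printing Implicit Defensive.

Definition upd (B : Type) (n : nat) (bs : {ffun 'I_n -> B}) (i : 'I_n) (b : B) :
    {ffun 'I_n -> B} :=
  [ffun j => if j == i then b else bs j].

Record signature := Signature { symb :> Type; arity : symb -> nat }.

Inductive term (Sig : signature) (V : Type) : Type :=
| Var (x : V)
| App (f : Sig) (ts : {ffun 'I_(arity f) -> term Sig V}).

Arguments Var Sig {V} x.
Arguments App {Sig V} f ts.

Section Rewriting.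
Variables (Sig : signature) (V : Type).
Local Notation term := (term Sig V).

Fixpoint occurs (x : V) (t : term) : Prop :=
  match t with
  | Var y => y = x
  | App f ts => exists i, occurs x (ts i)
  end.

Definition ground (t : term) : Prop := forall x, ~ occurs x t.

Fixpoint subst (sigma : V -> term) (t : term) : term :=
  match t with
  | Var x => sigma x
  | App f ts => App f [ffun i => subst sigma (ts i)]
  end.

Record trs := Trs {
  rule :> term -> term -> Prop;
  lhs_nonvar : forall l r, rule l r -> forall x, l <> Var Sig x;
  rhs_vars : forall l r, rule l r -> forall x, occurs x r -> occurs x l }.

Definition trsU (P Q : trs) : trs.
Proof.
refine (@Trs (fun l r => P l r \/ Q l r) _ _).
- by move=> l r [] /lhs_nonvar.
- by move=> l r [] /rhs_vars.
Defined.

Inductive rstep (P : trs) : term -> term -> Prop :=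
| rstep_root l r (sigma : V -> term) :
    P l r -> rstep P (subst sigma l) (subst sigma r)
| rstep_arg f (ts : {ffun 'I_(arity f) -> term}) i t' :
    rstep P (ts i) t' -> rstep P (App f ts) (App f (upd ts i t')).

Definition relstep (P Q : trs) (s t : term) : Prop :=
  exists u v, [/\ clos_refl_trans _ (rstep Q) s u, rstep P u v
                & clos_refl_trans _ (rstep Q) v t].

Definition terminating_relative (P Q : trs) (T : term -> Prop) : Prop :=
  ~ exists s : nat -> term, T (s 0) /\ forall n, relstep P Q (s n) (s n.+1).

End Rewriting.

(* [op f bs = None] means that the operation of [f] is undefined at [bs]. *)
Record partial_algebra (Sig : signature) := PartialAlgebra {
  carrier :> Type;
  op : forall f : Sig, {ffun 'I_(arity f) -> carrier} -> option carrier }.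

Arguments op {Sig} p f bs : rename.

Definition some_val (B : Type) (o : option B) : isSome o -> B :=
  match o with
  | Some b => fun=> b
  | None => fun h => False_rect B (notF h)
  end.

Definition all_some (B : Type) (n : nat) (os : 'I_n -> option B) :
    option {ffun 'I_n -> B} :=
  match @forallP _ (fun i => isSome (os i)) with
  | ReflectT h => Some [ffun i => some_val (h i)]
  | ReflectF _ => None
  end.

Section PartialModels.
Variables (Sig : signature) (V : Type) (A : partial_algebra Sig).

Fixpoint interp (alpha : V -> option A) (t : term Sig V) : option A :=
  match t with
  | Var x => alpha x
  | App f ts => obind (op A f) (all_some (fun i => interp alpha (ts i)))
  end.

(* A function from Var(t) to A is encoded as a partial function on V whose
   domain is exactly Var(t); in particular the one from Var(t) = {} to A is
   [fun=> None]. *)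
Definition assignment_on (t : term Sig V) (alpha : V -> option A) : Prop :=
  forall x, isSome (alpha x) <-> occurs x t.

Definition language (t : term Sig V) : Prop :=
  ground t /\ isSome (interp (fun=> None) t).

Variable ge : A -> A -> Prop.

Definition closed_wrt : Prop :=
  forall (f : Sig) (bs : {ffun 'I_(arity f) -> A}) (i : 'I_(arity f)) (b : A),
    isSome (op A f bs) -> ge (bs i) b -> isSome (op A f (upd bs i b)).

Definition monotone_wrt : Prop :=
  forall (f : Sig) (bs : {ffun 'I_(arity f) -> A}) (i : 'I_(arity f))
         (b c d : A),
    op A f bs = Some c -> op A f (upd bs i b) = Some d ->
    ge (bs i) b -> ge c d.

Definition monotone_partial_model (P : trs Sig V) : Prop :=
  [/\ closed_wrt, monotone_wrt
    & forall l r, P l r -> forall alpha, assignment_on l alpha ->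
      forall a, interp alpha l = Some a ->
      exists2 b, interp alpha r = Some b & ge a b].

End PartialModels.

(* Main.v *)
Require Import Defs.
From Stdlib Require Import Relation_Operators.
From mathcomp Require Import all_boot.
From Stdlib Require Import ClassicalEpsilon.

(** Rewriting with rules of a monotone partial model preserves definedness of
    the interpretation, so every term reachable from [T] is defined.  A term
    containing an instance of a left-hand side of [R'] is undefined, hence no
    [R']-step is ever taken from [T], and every relative [R U R']-sequence from
    [T] is already a relative [R]-sequence. *)

Set Implicit Arguments.
Unset Strict Implicit.
Unset Printing Implicit Defensive.

(* The induction principle generated for [term] has no hypotheses for the
   subterms hidden under [{ffun _ -> _}]. *)
Fixpoint term_ind_args (Sig : signature) (V : Type) (P : term Sig V -> Prop)
    (PVar : forall x, P (Var Sig x))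
    (PApp : forall (f : Sig) (ts : {ffun 'I_(arity f) -> term Sig V}),
       (forall i, P (ts i)) -> P (App f ts))
    (t : term Sig V) : P t :=
  match t with
  | Var x => PVar x
  | App f ts => PApp f ts (fun i => term_ind_args PVar PApp (ts i))
  end.

Lemma some_valK (B : Type) (o : option B) (h : isSome o) : Some (some_val h) = o.
Proof. by case: o h. Qed.

Lemma all_someP (B : Type) (n : nat) (os : 'I_n -> option B) (bs : {ffun 'I_n -> B}) :
  all_some os = Some bs <-> forall i, os i = Some (bs i).
Proof.
rewrite /all_some; case: forallP => [h|nh]; split=> //.
- by move=> [<-] i; rewrite ffunE some_valK.
- move=> eq_os; congr Some; apply/ffunP=> i; rewrite ffunE.
  by apply: Some_inj; rewrite some_valK.
- by move=> eq_os; case: nh => i; rewrite eq_os.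
Qed.

(** The recursive calls of [interp] sit inside a function of the argument index; this allows
    rewriting there without functional extensionality. *)
Lemma eq_all_some (B : Type) (n : nat) (os os' : 'I_n -> option B) :
  os =1 os' -> all_some os = all_some os'.
Proof.
move=> eq_os; case E: (all_some os') => [bs|].
  by apply/all_someP => i; rewrite eq_os; move/all_someP: E.
case E': (all_some os) => [bs|] //.
by rewrite -E; apply/esym/all_someP => i; rewrite -eq_os; move/all_someP: E'.
Qed.

Section Interpretation.
Variables (Sig : signature) (V : Type) (A : partial_algebra Sig).
Implicit Types (alpha beta : V -> option A) (t : term Sig V) (P Q : trs Sig V).

Lemma interp_AppP alpha f (ts : {ffun 'I_(arity f) -> term Sig V}) a :
  interp alpha (App f ts) = Some a <->
  exists2 bs : {ffun 'I_(arity f) -> A},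
    forall i, interp alpha (ts i) = Some (bs i) & op A f bs = Some a.
Proof.
rewrite /=; split=> [|[bs /all_someP -> //]].
by case E: (all_some _) => [bs|] //= op_bs; exists bs => //; apply/all_someP.
Qed.

Lemma eq_in_interp alpha beta t :
  (forall x, occurs x t -> alpha x = beta x) -> interp alpha t = interp beta t.
Proof.
elim/term_ind_args: t => [x|f ts IH] /= eq_ab; first exact: eq_ab.
by congr obind; apply: eq_all_some => i; apply: IH => x x_ti; apply: eq_ab; exists i.
Qed.

Lemma interp_subst beta sigma t :
  interp beta (subst sigma t) = interp (fun x => interp beta (sigma x)) t.
Proof.
elim/term_ind_args: t => [x|f ts IH] //=.
by congr obind; apply: eq_all_some => i; rewrite ffunE.
Qed.

Lemma interp_occurs alpha t a x :
  interp alpha t = Some a -> occurs x t -> isSome (alpha x).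
Proof.
elim/term_ind_args: t a => [y|f ts IH] a; first by move=> /= + <- => ->.
by case/interp_AppP=> bs ts_bs _ [i]; apply: IH (ts_bs i).
Qed.

(** Bridges to the model conditions, which concern only assignments with domain exactly the
    variables of a left-hand side, whereas [fun x => interp beta (sigma x)] may be defined on
    further variables. *)
Lemma assignment_on_restriction alpha t a :
  interp alpha t = Some a ->
  exists2 beta, assignment_on t beta & forall x, occurs x t -> beta x = alpha x.
Proof.
move=> t_a.
(* [V] is an arbitrary type, so occurrence in [t] is decided classically. *)
exists (fun x => if excluded_middle_informative (occurs x t) then alpha x else None).
  move=> x; case: excluded_middle_informative => [x_t|//]; split=> // _.
  exact: interp_occurs t_a x_t.
by move=> x x_t; case: excluded_middle_informative.
Qed.

Lemma sub_monotone_partial_model (ge : A -> A -> Prop) P Q :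
  (forall l r, P l r -> Q l r) ->
  monotone_partial_model ge Q -> monotone_partial_model ge P.
Proof. by move=> PQ [cl mono rules]; split=> // l r /PQ; apply: rules. Qed.

(** Induction on the step. At the root, the model condition applies to the substitution composed
    with [beta]; below a symbol, closedness gives definedness and monotonicity the inequality. *)
Lemma rstep_interp (ge : A -> A -> Prop) P beta s t a :
  monotone_partial_model ge P -> rstep P s t -> interp beta s = Some a ->
  exists2 b, interp beta t = Some b & ge a b.
Proof.
case=> cl mono rules st; elim: st a => {s t} [l r sigma lr|f ts i t' _ IH] a.
  rewrite !interp_subst => l_a.
  have [alpha on_l eq_alpha] := assignment_on_restriction l_a.
  rewrite -(eq_in_interp eq_alpha) in l_a.
  have [b r_b ab] := rules _ _ lr _ on_l _ l_a.
  (* The restricted assignment also agrees on [r], whose variables all occur in [l]. *)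
  exists b => //; rewrite -r_b; apply: eq_in_interp => x x_r.
  by rewrite eq_alpha //; apply: rhs_vars lr _ x_r.
case/interp_AppP=> bs ts_bs op_bs; have [b t'_b ge_b] := IH _ (ts_bs i).
have /cl/(_ ge_b) : isSome (op A f bs) by rewrite op_bs.
case op_upd: (op A f (upd bs i b)) => [d|] // _.
exists d; last exact: mono op_bs op_upd ge_b.
apply/interp_AppP; exists (upd bs i b) => // j.
by rewrite !ffunE; case: eqP.
Qed.

(** Only definedness is carried along: [ge] is an arbitrary relation, so the inequalities of single
    steps need not compose. *)
Lemma rsteps_interp (ge : A -> A -> Prop) P beta s t :
  monotone_partial_model ge P -> clos_refl_trans _ (rstep P) s t ->
  isSome (interp beta s) -> isSome (interp beta t).
Proof.
move=> mod; elim=> {s t} [s t st|//|s u t _ IHs _ IHt /IHs//].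
by case E: (interp beta s) => [a|] // _; have [b ->] := rstep_interp mod st E.
Qed.

(** A defined instance of [l] would make [l] itself defined under an assignment on its variables.
    Undefinedness then passes to every context, since a term is defined only if all its arguments
    are. *)
Lemma rstep_undef P beta s t :
  (forall l r, P l r -> forall alpha, assignment_on l alpha -> interp alpha l = None) ->
  rstep P s t -> interp beta s = None.
Proof.
move=> undef; elim=> {s t} [l r sigma lr|f ts i t' _ IH].
  rewrite interp_subst; case E: (interp _ l) => [a|] //.
  have [alpha on_l eq_alpha] := assignment_on_restriction E.
  by rewrite -E -(eq_in_interp eq_alpha); apply: undef lr _ on_l.
case E: (interp _ _) => [a|] //.
by have /interp_AppP[bs /(_ i)] := E; rewrite IH.
Qed.

End Interpretation.

Lemma rstep_trsU (Sig : signature) (V : Type) (P Q : trs Sig V) (s t : term Sig V) :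
  rstep (trsU P Q) s t -> rstep P s t \/ rstep Q s t.
Proof.
elim=> {s t} [l r sigma []|f ts i t' _ []] st.
- by left; apply: rstep_root.
- by right; apply: rstep_root.
- by left; apply: rstep_arg.
- by right; apply: rstep_arg.
Qed.

Theorem theorem9p8 (Sig : signature) (V : Type) (R R' S : trs Sig V)
    (T : term Sig V -> Prop) (T_ground : forall t, T t -> ground t)
    (A : partial_algebra Sig) (ge : A -> A -> Prop)
    (model : monotone_partial_model ge (trsU (trsU R R') S))
    (T_lang : forall t, T t -> language A t)
    (R'_undef : forall l r, R' l r ->
       forall alpha : V -> option A, assignment_on l alpha ->
       interp alpha l = None) :
  terminating_relative R S T -> terminating_relative (trsU R R') S T.
Proof.
move=> termR [s [T_s0 steps]]; apply: termR; exists s; split=> // n.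
have modS : monotone_partial_model ge S.
  by apply: sub_monotone_partial_model model => l r; right.
have modR : monotone_partial_model ge R.
  by apply: sub_monotone_partial_model model => l r; left; left.
(* The invariant along the sequence. Being defined under the empty assignment also forces a term to
   be ground. *)
pose defd (t : term Sig V) := isSome (interp (fun=> None : option A) t).
(* Both conclusions come together: once the middle step is known to use [R], the model property of
   [R] carries definedness across it. *)
have step_def u v w x : defd u -> clos_refl_trans _ (rstep S) u v ->
    rstep (trsU R R') v w -> clos_refl_trans _ (rstep S) w x ->
    rstep R v w /\ defd x.
  move=> def_u uv vw wx.
  have def_v : defd v by apply: rsteps_interp modS uv def_u.
  have vwR : rstep R v w.
    case/rstep_trsU: vw => // /(rstep_undef (fun=> None) R'_undef) v0.
    by rewrite /defd v0 in def_v.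
  split=> //; apply: rsteps_interp modS wx _.
  by apply: rsteps_interp modR _ def_v; apply: rt_step.
(* Induction along the sequence, started by the inclusion of [T] in the language of [A]. *)
have def_s k : defd (s k).
  elim: k => [|k IH]; first by case: (T_lang _ T_s0).
  by have [u [v [su uv vs]]] := steps k; case: (step_def _ _ _ _ IH su uv vs).
have [u [v [su uv vs]]] := steps n; exists u, v.
by have [uvR _] := step_def _ _ _ _ (def_s n) su uv vs.
Qed.
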